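(* Let $k\ge 2$, let $n_1<n_2<\cdots<n_k$ be positive integers with $\gcd(n_1,\ldots,n_k)=1$, and let $S=\langle n_1,\ldots,n_k\rangle$. Let $d$, $A_i$ ($0\le i<n_1$), $A'_{i'}$ ($0\le i'<n_k$), $\mathsf L(n)$, $\mathsf M(n)$ and $\mathsf m(n)$ be as defined in the context. Then there exists $N$ such that for every $n\in S$ with $n\ge N$, if $i\in\{0,\ldots,n_1-1\}$ and $i'\in\{0,\ldots,n_k-1\}$ are given by $n\equiv i \bmod n_1$ and $n\equiv i' \bmod n_k$, then $$\mathsf L(n)=\{\mathsf m(n),\,\mathsf m(n)+d,\,\ldots,\,\mathsf M(n)-d,\,\mathsf M(n)\}\setminus\big((dA'_{i'}+\mathsf m(n))\cup(-dA_i+\mathsf M(n))\big).$$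
   Context: For positive integers $g_1,\ldots,g_r$, $\langle g_1,\ldots,g_r\rangle=\{q_1g_1+\cdots+q_rg_r : q_j\in\mathbb Z_{\ge 0}\}$. The generators $n_1,\ldots,n_k$ of $S$ are fixed and need not be a minimal generating set. For $n\in S$, the length set is $\mathsf L(n)=\{q_1+\cdots+q_k : q_1,\ldots,q_k\in\mathbb Z_{\ge 0},\ n=q_1n_1+\cdots+q_kn_k\}$, and $\mathsf M(n)=\max\mathsf L(n)$, $\mathsf m(n)=\min \mathsf L(n)$. Let $S_{\mathsf M}=\langle n_2-n_1,n_3-n_1,\ldots,n_k-n_1\rangle$ and $S_{\mathsf m}=\langle n_k-n_1,n_k-n_2,\ldots,n_k-n_{k-1}\rangle$, and let $d=\gcd(S_{\mathsf M})=\gcd(S_{\mathsf m})$ (these two gcds are equal). Since $\gcd(d,n_1)=\gcd(d,n_k)=1$, $S_{\mathsf M}$ meets every residue class modulo $n_1$ and $S_{\mathsf m}$ meets every residue class modulo $n_k$. For $0\le i<n_1$ let $b_{i1}$ be the smallest element of $S_{\mathsf M}$ congruent to $i$ modulo $n_1$, and let $A_i=\{r\in\mathbb Z_{\ge 1} : b_{i1}+r\,d\,n_1\notin S_{\mathsf M}\}$. For $0\le i'<n_k$ let $c_{i'1}$ be the smallest element of $S_{\mathsf m}$ with $c_{i'1}+i'\equiv 0\bmod n_k$, and let $A'_{i'}=\{r'\in\mathbb Z_{\ge 1} : c_{i'1}+r'\,d\,n_k\notin S_{\mathsf m}\}$. For a set $A$ of integers and an integer $m$, $dA+m=\{da+m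 : a\in A\}$ and $-dA+m=\{-da+m : a\in A\}$. The set $\{\mathsf m(n),\mathsf m(n)+d,\ldots,\mathsf M(n)\}$ is the arithmetic progression with step $d$ from $\mathsf m(n)$ to $\mathsf M(n)$ (note $d\mid \mathsf M(n)-\mathsf m(n)$). *)

(* Defs.v *)
From mathcomp Require Import all_boot all_order all_algebra.
From mathcomp Require Import boolp classical_sets.

Set Implicit Arguments.
Unset Strict Implicit.
Unset Printing Implicit Defensive.

Import Order.TTheory GRing.Theory Num.Theory.

Local Open Scope classical_set_scope.

(* The three functions below return the junk value 0 when the requested
   element does not exist; [set_maxP], [set_minP] and [set_gcdP] give the
   conditions under which they return a genuine maximum, minimum or gcd. *)
Definition set_max (A : set nat) : nat := xget 0 (A `&` ubound A).

Definition set_min (A : set nat) : nat := xget 0 (A `&` lbound A).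

Definition common_divisors (A : set nat) : set nat :=
  [set e | forall x, A x -> e %| x].

Definition set_gcd (A : set nat) : nat :=
  xget 0 [set e | common_divisors A e /\
                  forall f, common_divisors A f -> f %| e].

Lemma set_minP (A : set nat) : A !=set0 -> (A `&` lbound A) (set_min A).
Proof.
move=> [x Ax]; apply: xgetPex.
have exA : exists n, `[< A n >] by exists x; apply/asboolP.
exists (ex_minn exA); case: ex_minnP => m /asboolP Am le_m; split => // y Ay.
by rewrite leEnat; apply/le_m/asboolP.
Qed.

Lemma set_maxP (A : set nat) : A !=set0 -> has_ubound A ->
  (A `&` ubound A) (set_max A).
Proof.
move=> [x Ax] [u uA]; apply: xgetPex.
have exA : exists n, `[< A n >] by exists x; apply/asboolP.
have leA n : `[< A n >] -> n <= u by move/asboolP/uA; rewrite leEnat.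
exists (ex_maxn exA leA); case: ex_maxnP => m /asboolP Am ge_m.
by split => // y Ay; rewrite leEnat; apply/ge_m/asboolP.
Qed.

Lemma set_gcdP (A : set nat) : common_divisors A (set_gcd A) /\
  (forall f, common_divisors A f -> f %| set_gcd A).
Proof.
pose G := [set e | common_divisors A e /\
                   forall f, common_divisors A f -> f %| e].
suff : exists e, G e by move/(xgetPex 0).
have [[x [Ax x_gt0]]|A0] := pselect (exists x, A x /\ 0 < x); last first.
  exists 0; split=> [y Ay|f _]; last exact: dvdn0.
  by rewrite dvd0n; apply: contrapT => /negP; rewrite -lt0n => y0; case: A0; exists y.
have Dlcm e f : common_divisors A e -> common_divisors A f ->
    common_divisors A (lcmn e f).
  by move=> De Df y Ay; rewrite dvdn_lcm De // Df.
have exD : exists n, `[< common_divisors A n >].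
  by exists 1; apply/asboolP => y _; exact: dvd1n.
have leD n : `[< common_divisors A n >] -> n <= x.
  by move/asboolP/(_ _ Ax)/(dvdn_leq x_gt0).
exists (ex_maxn exD leD); case: ex_maxnP => m /asboolP Dm max_m; split=> // f Df.
have m_gt0 : 0 < m by apply: max_m; apply/asboolP => y _; exact: dvd1n.
have Dl := Dlcm _ _ Dm Df.
have l_gt0 : 0 < lcmn m f by apply: dvdn_gt0 x_gt0 (Dl _ Ax).
have lem : lcmn m f <= m by apply: max_m; apply/asboolP.
suff <- : lcmn m f = m by exact: dvdn_lcmr.
by apply/eqP; rewrite eqn_leq lem dvdn_leq // dvdn_lcml.
Qed.

Definition gen_monoid (g : seq nat) : set nat :=
  [set x | exists q : 'I_(size g) -> nat,
             x = \sum_(j < size g) q j * nth 0 g j].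

Section LengthSets.

(* [gens] is the sequence n_1, ..., n_k, assumed increasing in all uses, so
   that the truncated differences below are genuine ones. *)
Variable gens : seq nat.

Definition length_set (n : nat) : set nat :=
  [set l | exists q : 'I_(size gens) -> nat,
             l = \sum_(j < size gens) q j /\
             n = \sum_(j < size gens) q j * nth 0 gens j].

Definition max_length (n : nat) : nat := set_max (length_set n).
Definition min_length (n : nat) : nat := set_min (length_set n).

Definition gen_first : nat := head 0 gens.
Definition gen_last : nat := last 0 gens.

Definition monoid_M : set nat :=
  gen_monoid [seq x - gen_first | x <- behead gens].
Definition monoid_m : set nat :=
  gen_monoid [seq gen_last - x | x <- take (size gens).-1 gens].

(* For increasing generators, [monoid_m] has the same gcd: both generating
   families have the same integer span of differences n_a - n_b. *)
Definition step : nat := set_gcd monoid_M.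

Definition b1 (i : nat) : nat :=
  set_min [set x | monoid_M x /\ x = i %[mod gen_first]].
Definition c1 (i : nat) : nat :=
  set_min [set x | monoid_m x /\ x + i = 0 %[mod gen_last]].

Definition gaps_M (i : nat) : set nat :=
  [set r | 1 <= r /\ ~ monoid_M (b1 i + r * step * gen_first)].
Definition gaps_m (i : nat) : set nat :=
  [set r | 1 <= r /\ ~ monoid_m (c1 i + r * step * gen_last)].

End LengthSets.

Local Open Scope ring_scope.

(* The image in the integers of a set of naturals under a |-> e * a + m;
   integers are needed because e may be negative. *)
Definition dilate_shift (e : int) (A : set nat) (m : int) : set int :=
  [set e * a%:Z + m | a in A].

Definition progression (a d b : nat) : set int :=
  [set (a + j * d)%N%:Z | j in [set j : nat | (a + j * d <= b)%N]].

(* Main.v *)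
(* Write a = n_1, b = n_k. A factorization of n of length l gives
   x = n - l a in S_M and y = l b - n in S_m, with x + y = l (b - a).
   Conversely, x in S_M yields a factorization of length l as soon as x is a sum
   of at most l generators of S_M. Every x in S_M is a sum of at most
   (x + s) / (b - a) of them, with s independent of x, so x in S_M suffices when
   y >= s; symmetrically, y in S_m suffices when x is large. Since x + y grows
   with n, for n large l is a length of n if and only if x is in S_M and y is in
   S_m. In particular n - M(n) a = b_{i1} and m(n) b - n = c_{i'1}, and the
   lengths missing from the progression are those for which x is not in S_M
   or y is not in S_m. *)
Require Import Defs.
From mathcomp Require Import all_boot all_order all_algebra.
From mathcomp Require Import boolp classical_sets.
From mathcomp Require Import zify.

Local Open Scope classical_set_scope.

(** * Coefficient families indexed by all naturals *)

(** Coefficients defined on all of [nat] can be shifted, as in [gen_monoid_cons0], without casts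
    between ordinal types. *)
Lemma extend_ord_fun (k : nat) (q : 'I_k -> nat) :
  exists q' : nat -> nat, forall i : 'I_k, q' i = q i.
Proof. by exists (fun j => oapp q 0 (insub j)) => i; rewrite valK. Qed.

Lemma gen_monoidP (s : seq nat) (x : nat) :
  gen_monoid s x <->
  exists q : nat -> nat, x = \sum_(j < size s) q j * nth 0 s j.
Proof.
split=> [[q ->]|[q ->]]; last by exists (fun j => q j).
have [q' q'E] := extend_ord_fun _ q.
by exists q'; apply: eq_bigr => j _; rewrite q'E.
Qed.

(** Used in [monoid_MP] to add the zero difference n_1 - n_1, so that elements of [monoid_M] and
    factorizations of n share one index set. *)
Lemma gen_monoid_cons0 (s : seq nat) : gen_monoid (0 :: s) = gen_monoid s.
Proof.
apply/seteqP; split=> x /gen_monoidP[q ->]; apply/gen_monoidP.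
  by exists (fun j => q j.+1); rewrite big_ord_recl muln0.
by exists (fun j => q j.-1); rewrite big_ord_recl muln0.
Qed.

Lemma gen_monoid_rcons0 (s : seq nat) : gen_monoid (rcons s 0) = gen_monoid s.
Proof.
have sumE (q : nat -> nat) :
  \sum_(j < size (rcons s 0)) q j * nth 0 (rcons s 0) j =
  \sum_(j < size s) q j * nth 0 s j.
  rewrite size_rcons big_ord_recr /= nth_rcons ltnn eqxx muln0 addn0.
  by apply: eq_bigr => j _; rewrite nth_rcons ltn_ord.
by apply/seteqP; split=> x /gen_monoidP[q ->]; apply/gen_monoidP;
  exists q; rewrite sumE.
Qed.

Lemma gen_monoid_mapP (f : nat -> nat) (s : seq nat) (x : nat) :
  gen_monoid [seq f y | y <- s] x <->
  exists q : nat -> nat, x = \sum_(j < size s) q j * f (nth 0 s j).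
Proof.
have sumE (q : nat -> nat) :
  \sum_(j < size (map f s)) q j * nth 0 (map f s) j =
  \sum_(j < size s) q j * f (nth 0 s j).
  by rewrite size_map; apply: eq_bigr => j _; rewrite (nth_map 0).
by split=> [/gen_monoidP[q ->]|[q ->]]; [|apply/gen_monoidP];
  exists q; rewrite sumE.
Qed.

Lemma length_setP (g : seq nat) (n l : nat) :
  length_set g n l <-> exists q : nat -> nat,
    l = \sum_(j < size g) q j /\ n = \sum_(j < size g) q j * nth 0 g j.
Proof.
split=> [[q [-> ->]]|[q [-> ->]]]; last by exists (fun j => q j).
have [q' q'E] := extend_ord_fun _ q.
by exists q'; split; apply: eq_bigr => j _; rewrite q'E.
Qed.

(** * Controlling the number of summands *)

Lemma sum_mul_delta (k : nat) (j0 : 'I_k) (c : nat) (f : nat -> nat) :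
  \sum_(j < k) (j == j0 :> nat) * c * f j = c * f j0.
Proof.
rewrite (bigD1 j0) //= eqxx mul1n big1 ?addn0 // => j /negPf.
by rewrite -val_eqE => ->; rewrite !mul0n.
Qed.

Lemma sum_delta (k : nat) (j0 : 'I_k) (c : nat) :
  \sum_(j < k) (j == j0 :> nat) * c = c.
Proof.
rewrite -[RHS]muln1 -(sum_mul_delta k j0 c (fun=> 1)).
by apply: eq_bigr => j _; rewrite muln1.
Qed.

(* Only the minimal element of each residue class modulo [D] matters: the other
   elements of the class are reached by adding copies of the generator [D],
   each of which contributes exactly [D] to [D * \sum q' j]. *)
Lemma bounded_excess (k : nat) (v : nat -> nat) (j0 : 'I_k) :
  0 < v j0 ->
  exists s, forall q : nat -> nat, exists q' : nat -> nat,
    \sum_(j < k) q' j * v j = \sum_(j < k) q j * v j /\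
    v j0 * (\sum_(j < k) q' j) <= \sum_(j < k) q j * v j + s.
Proof.
move=> D_gt0; set D := v j0 in D_gt0 *.
have class_bound (r : 'I_D) : exists s, forall q : nat -> nat,
    (\sum_(j < k) q j * v j) %% D = r -> exists q' : nat -> nat,
    \sum_(j < k) q' j * v j = \sum_(j < k) q j * v j /\
    D * (\sum_(j < k) q' j) <= \sum_(j < k) q j * v j + s.
  pose A := [set x | x %% D = r /\
    exists q : nat -> nat, x = \sum_(j < k) q j * v j].
  have [A0|A0] := pselect (A !=set0); last first.
    exists 0 => q qr; case: A0; exists (\sum_(j < k) q j * v j).
    by split=> //; exists q.
  have [[xr [q0 x0E]] minx] := set_minP A0.
  set x0 := set_min A in xr x0E minx.
  exists (D * \sum_(j < k) q0 j) => q; set x := \sum_(j < k) q j * v j => xqr.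
  have le_x0x : x0 <= x by rewrite -leEnat; apply: minx; split=> //; exists q.
  have /dvdnP[p xE] : D %| x - x0 by rewrite -eqn_mod_dvd // xr xqr.
  exists (fun j => q0 j + (j == j0 :> nat) * p); split.
    under eq_bigr do rewrite mulnDl.
    by rewrite big_split /= sum_mul_delta -x0E -/D -xE subnKC.
  by rewrite big_split /= sum_delta mulnDr; lia.
have [s sP] := fin_all_exists class_bound.
exists (\max_(r < D) s r) => q.
have ltr : (\sum_(j < k) q j * v j) %% D < D by rewrite ltn_mod.
have [q' [q'E q'le]] := sP (Ordinal ltr) q erefl.
exists q'; split=> //; apply: leq_trans q'le _.
by rewrite leq_add2l (leq_bigmax (Ordinal ltr)).
Qed.

(** By [bounded_excess] some representation has at most [l] terms, since its value plus [s] is at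
    most [l * v j0]; copies of the zero generator [v j1] then bring the count to exactly [l]. *)
Lemma exact_count (k : nat) (v : nat -> nat) (j0 j1 : 'I_k) :
  0 < v j0 -> v j1 = 0 ->
  exists Y, forall (q : nat -> nat) (y l : nat), Y <= y ->
    \sum_(j < k) q j * v j + y = l * v j0 ->
    exists q' : nat -> nat, \sum_(j < k) q' j = l /\
      \sum_(j < k) q' j * v j = \sum_(j < k) q j * v j.
Proof.
move=> D_gt0 v1; have [s sP] := bounded_excess k v j0 D_gt0.
exists s => q y l le_sy xyE; have [q' [q'E q'le]] := sP q.
have le_ql : \sum_(j < k) q' j <= l.
  by rewrite -(leq_pmul2l D_gt0); lia.
exists (fun j => q' j + (j == j1 :> nat) * (l - \sum_(j < k) q' j)); split.
  by rewrite big_split /= sum_delta subnKC.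
under eq_bigr do rewrite mulnDl.
by rewrite big_split /= sum_mul_delta v1 muln0 addn0.
Qed.

(** * Differences of increasing generators and the two monoids *)

Lemma sorted_nth_bounds (g : seq nat) (j : nat) :
  sorted ltn g -> j < size g ->
  gen_first g <= nth 0 g j <= gen_last g.
Proof.
move=> sg ltj.
have sg' : sorted leq g by apply: sub_sorted sg => x y; exact: ltnW.
have nth_le := sorted_leq_nth leq_trans leqnn 0 sg'.
rewrite /gen_first /gen_last -nth0 (last_nth 0) /=.
case: g ltj {sg sg'} nth_le => // x s ltj nth_le /=.
move: ltj => /= ltj; rewrite (nth_le 0 j) ?(nth_le j (size s)) ?inE /=; lia.
Qed.

Lemma monoid_MP (g : seq nat) (x : nat) : 0 < size g ->
  monoid_M g x <->
  exists q : nat -> nat,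
    x = \sum_(j < size g) q j * (nth 0 g j - gen_first g).
Proof.
case: g => // y s _.
by rewrite -(gen_monoid_mapP (subn^~ (gen_first (y :: s)))) /= subnn
           gen_monoid_cons0.
Qed.

Lemma monoid_mP (g : seq nat) (x : nat) : 0 < size g ->
  monoid_m g x <->
  exists q : nat -> nat,
    x = \sum_(j < size g) q j * (gen_last g - nth 0 g j).
Proof.
case/lastP: g => // s y _.
rewrite -(gen_monoid_mapP (subn (gen_last (rcons s y)))) map_rcons.
rewrite /monoid_m /gen_last last_rcons subnn gen_monoid_rcons0 size_rcons.
by rewrite -cats1 take_size_cat.
Qed.

Lemma sum_nthE (g : seq nat) (q : nat -> nat) : sorted ltn g ->
  \sum_(j < size g) q j * nth 0 g j =
  \sum_(j < size g) q j * (nth 0 g j - gen_first g) +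
  (\sum_(j < size g) q j) * gen_first g.
Proof.
move=> sg; rewrite big_distrl -big_split /=; apply: eq_bigr => j _.
have /andP[le_fj _] := sorted_nth_bounds g j sg (ltn_ord j).
by rewrite -mulnDr subnK.
Qed.

Lemma sum_nth_lastE (g : seq nat) (q : nat -> nat) : sorted ltn g ->
  \sum_(j < size g) q j * (gen_last g - nth 0 g j) +
  \sum_(j < size g) q j * nth 0 g j =
  (\sum_(j < size g) q j) * gen_last g.
Proof.
move=> sg; rewrite big_distrl -big_split /=; apply: eq_bigr => j _.
have /andP[_ le_jl] := sorted_nth_bounds g j sg (ltn_ord j).
by rewrite -mulnDr subnK.
Qed.

Lemma gen_first_lt_last (g : seq nat) :
  sorted ltn g -> 1 < size g -> gen_first g < gen_last g.
Proof.
move=> sg lt1g; rewrite /gen_first /gen_last -nth0 -nth_last.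
by apply: (sorted_ltn_nth ltn_trans 0 sg); rewrite ?inE; lia.
Qed.

Lemma length_set_M (g : seq nat) (n l : nat) :
  sorted ltn g -> 0 < size g -> length_set g n l ->
  exists2 x, monoid_M g x & x + l * gen_first g = n.
Proof.
move=> sg g0 /length_setP[q [-> ->]].
exists (\sum_(j < size g) q j * (nth 0 g j - gen_first g)).
  by apply/monoid_MP => //; exists q.
by rewrite -sum_nthE.
Qed.

Lemma length_set_m (g : seq nat) (n l : nat) :
  sorted ltn g -> 0 < size g -> length_set g n l ->
  exists2 y, monoid_m g y & y + n = l * gen_last g.
Proof.
move=> sg g0 /length_setP[q [-> ->]].
exists (\sum_(j < size g) q j * (gen_last g - nth 0 g j)).
  by apply/monoid_mP => //; exists q.
by rewrite sum_nth_lastE.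
Qed.

(** Here x + y = l (n_k - n_1), so [exact_count] applies with n_k - n_1 as [v j0]; the zero
    difference used for padding stands for copies of n_1. *)
Lemma length_of_monoid_M (g : seq nat) : sorted ltn g -> 1 < size g ->
  exists Y, forall n l x y, monoid_M g x -> Y <= y ->
    x + l * gen_first g = n -> y + n = l * gen_last g -> length_set g n l.
Proof.
move=> sg lt1g; have g0 := ltnW lt1g.
have ltl : (size g).-1 < size g by rewrite prednK.
have lt_fl := gen_first_lt_last g sg lt1g.
have D_gt0 : 0 < nth 0 g (Ordinal ltl) - gen_first g.
  by rewrite nth_last subn_gt0.
have v0 : nth 0 g (Ordinal g0) - gen_first g = 0.
  by rewrite /= nth0 subnn.
have [Y YP] := exact_count _ (fun j => nth 0 g j - gen_first g) _ _ D_gt0 v0.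
exists Y => n l x y /(monoid_MP _ _ g0)[q xE] leY xn yn.
have [|q' [q'l q'x]] := YP q y l leY.
  by rewrite /= nth_last -xE -/(gen_last g) mulnBr; lia.
apply/length_setP; exists q'; split=> //.
by rewrite sum_nthE // q'x -xE q'l.
Qed.

(** Mirror image: n_1 now carries the largest difference, and the padding consists of copies of
    n_k. *)
Lemma length_of_monoid_m (g : seq nat) : sorted ltn g -> 1 < size g ->
  exists X, forall n l x y, monoid_m g y -> X <= x ->
    x + l * gen_first g = n -> y + n = l * gen_last g -> length_set g n l.
Proof.
move=> sg lt1g; have g0 := ltnW lt1g.
have ltl : (size g).-1 < size g by rewrite prednK.
have lt_fl := gen_first_lt_last g sg lt1g.
have D_gt0 : 0 < gen_last g - nth 0 g (Ordinal g0).
  by rewrite /= nth0 subn_gt0.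
have v0 : gen_last g - nth 0 g (Ordinal ltl) = 0.
  by rewrite /= nth_last subnn.
have [X XP] := exact_count _ (fun j => gen_last g - nth 0 g j) _ _ D_gt0 v0.
exists X => n l x y /(monoid_mP _ _ g0)[q yE] leX xn yn.
have [|q' [q'l q'y]] := XP q x l leX.
  by rewrite /= nth0 -yE -/(gen_first g) mulnBr; lia.
apply/length_setP; exists q'; split=> //.
by have := sum_nth_lastE g q' sg; rewrite q'y -yE q'l; lia.
Qed.

(** * Divisibility by [step] *)

Lemma step_dvd (g : seq nat) (x : nat) : monoid_M g x -> step g %| x.
Proof. by move=> Mx; have [+ _] := set_gcdP (monoid_M g); exact. Qed.

(** A common divisor of [step g] and n_1 divides every n_j = (n_j - n_1) + n_1. *)
Lemma coprime_step (g : seq nat) : sorted ltn g -> 0 < size g ->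
  \big[gcdn/0]_(j < size g) nth 0 g j = 1 -> coprime (step g) (gen_first g).
Proof.
move=> sg g0 gcd1; rewrite /coprime -dvdn1 -gcd1.
apply/dvdn_biggcdP => j _.
have /andP[le_fj _] := sorted_nth_bounds g j sg (ltn_ord j).
rewrite -(subnK le_fj) dvdn_add ?dvdn_gcdr //.
apply: dvdn_trans (dvdn_gcdl _ _) _; apply: step_dvd.
apply/monoid_MP => //; exists (fun i => (i == j :> nat) * 1).
by rewrite (sum_mul_delta _ j 1 (fun i => nth 0 g i - gen_first g)) mul1n.
Qed.

(** * Extremal lengths of large elements *)

(** The witness [x] keeps [set_min] off its junk value; in the applications it comes from a
    factorization of n. *)
Lemma b1P (g : seq nat) (i x : nat) : monoid_M g x ->
  x = i %[mod gen_first g] ->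
  [/\ monoid_M g (b1 g i), b1 g i = i %[mod gen_first g] & b1 g i <= x].
Proof.
move=> Mx xi.
have [|[Mb bi] minb] := @set_minP
  [set x | monoid_M g x /\ x = i %[mod gen_first g]].
  by exists x.
by split=> //; rewrite -leEnat; exact: minb.
Qed.

Lemma c1P (g : seq nat) (i y : nat) : monoid_m g y ->
  y + i = 0 %[mod gen_last g] ->
  [/\ monoid_m g (c1 g i), c1 g i + i = 0 %[mod gen_last g] & c1 g i <= y].
Proof.
move=> my yi.
have [|[mc ci] minc] := @set_minP
  [set y | monoid_m g y /\ y + i = 0 %[mod gen_last g]].
  by exists y.
by split=> //; rewrite -leEnat; exact: minc.
Qed.

Lemma max_lengthE (g : seq nat) (n l : nat) : length_set g n l ->
  (forall l', length_set g n l' -> l' <= l) -> max_length g n = l.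
Proof.
move=> Ll maxl.
have [||LM maxM] := @set_maxP (length_set g n); first by exists l.
  by exists l => l' /maxl; rewrite leEnat.
by apply/eqP; rewrite eqn_leq maxl //=; exact: maxM.
Qed.

Lemma min_lengthE (g : seq nat) (n l : nat) : length_set g n l ->
  (forall l', length_set g n l' -> l <= l') -> min_length g n = l.
Proof.
move=> Ll minl.
have [|Lm minm] := @set_minP (length_set g n); first by exists l.
by apply/eqP; rewrite eqn_leq minl // andbT; exact: minm.
Qed.

Lemma length_set_nonempty (g : seq nat) (n : nat) :
  gen_monoid g n -> exists l, length_set g n l.
Proof. by case=> q nE; exists (\sum_(j < size g) q j), q. Qed.

(** The quotient [l] of n - b1 by n_1 is a length for large n. Any length l' gives the element n -
    l' n_1 of S_M in the class of [i]; it is at least b1, so l' <= l. *)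
Lemma max_length_b1 (g : seq nat) :
  sorted ltn g -> 1 < size g -> 0 < gen_first g ->
  exists N, forall n i, gen_monoid g n -> N <= n -> i < gen_first g ->
    n = i %[mod gen_first g] ->
    [/\ length_set g n (max_length g n),
        forall l, length_set g n l -> l <= max_length g n &
        b1 g i + max_length g n * gen_first g = n].
Proof.
move=> sg lt1g a_gt0; have g0 := ltnW lt1g.
have lt_ab := gen_first_lt_last g sg lt1g.
have [Y YP] := length_of_monoid_M g sg lt1g.
pose B := \max_(i < gen_first g) b1 g i.
(* This bound forces l >= Y + B for the quotient [l] below, hence l n_k - n = l (n_k - n_1) - b1 >=
   l - B >= Y. *)
exists ((Y + B) * gen_first g + B) => n i Sn leNn lti ni.
have [l0 /(length_set_M _ _ _ sg g0)[x0 Mx0 x0n]] := length_set_nonempty g n Sn.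
have [|Mb bi b_le] := b1P g i x0 Mx0; first by rewrite -ni -x0n addnC modnMDl.
have le_bB : b1 g i <= B := leq_bigmax (Ordinal lti).
have le_bn : b1 g i <= n by lia.
have /dvdnP[l lE] : gen_first g %| n - b1 g i by rewrite -eqn_mod_dvd // bi ni.
have le_l : Y + B <= l by rewrite -(leq_pmul2r a_gt0); lia.
have le_lab : l * (gen_first g).+1 <= l * gen_last g by rewrite leq_mul2l lt_ab orbT.
rewrite mulnS in le_lab.
have Ll : length_set g n l by apply: (YP n l _ (l * gen_last g - n) Mb); lia.
have maxl l' : length_set g n l' -> l' <= l.
  move=> /(length_set_M _ _ _ sg g0)[x Mx xn].
  have [|_ _ b_lex] := b1P g i x Mx; first by rewrite -ni -xn addnC modnMDl.
  by rewrite -(leq_pmul2r a_gt0); lia.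
by rewrite (max_lengthE _ _ _ Ll maxl); split=> //; lia.
Qed.

Lemma min_length_c1 (g : seq nat) :
  sorted ltn g -> 1 < size g -> 0 < gen_first g ->
  exists N, forall n i, gen_monoid g n -> N <= n -> i < gen_last g ->
    n = i %[mod gen_last g] ->
    [/\ length_set g n (min_length g n),
        forall l, length_set g n l -> min_length g n <= l &
        c1 g i + n = min_length g n * gen_last g].
Proof.
move=> sg lt1g a_gt0; have g0 := ltnW lt1g.
have lt_ab := gen_first_lt_last g sg lt1g.
have b_gt0 := ltn_trans a_gt0 lt_ab.
have [X XP] := length_of_monoid_m g sg lt1g.
pose C := \max_(i < gen_last g) c1 g i.
(* Below, l n_k = c1 + n, so this bound gives l >= X + C and n - l n_1 = l (n_k - n_1) - c1 >= X. *)
exists ((X + C) * gen_last g) => n i Sn leNn lti ni.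
have ciE y l : y + n = l * gen_last g -> y + i = 0 %[mod gen_last g].
  by move=> yn; rewrite -modnDmr -ni modnDmr yn modnMl mod0n.
have [l0 /(length_set_m _ _ _ sg g0)[y0 my0 y0n]] := length_set_nonempty g n Sn.
have [|mc ci _] := c1P g i y0 my0; first exact: ciE y0n.
have le_cC : c1 g i <= C := leq_bigmax (Ordinal lti).
have /dvdnP[l lE] : gen_last g %| c1 g i + n.
  by rewrite /dvdn -modnDmr ni modnDmr ci mod0n.
have le_l : X + C <= l by rewrite -(leq_pmul2r b_gt0); lia.
have le_lab : l * (gen_first g).+1 <= l * gen_last g by rewrite leq_mul2l lt_ab orbT.
rewrite mulnS in le_lab.
have Ll : length_set g n l by apply: (XP n l (n - l * gen_first g) _ mc); lia.
have minl l' : length_set g n l' -> l <= l'.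
  move=> /(length_set_m _ _ _ sg g0)[y my yn].
  have [|_ _ c_ley] := c1P g i y my; first exact: ciE yn.
  by rewrite -(leq_pmul2r b_gt0); lia.
by rewrite (min_lengthE _ _ _ Ll minl); split=> //; lia.
Qed.

(** * Recovering the full length set of a large element *)

Lemma length_of_monoids (g : seq nat) :
  sorted ltn g -> 1 < size g -> 0 < gen_first g ->
  exists N, forall n l x y, N <= n -> monoid_M g x -> monoid_m g y ->
    x + l * gen_first g = n -> y + n = l * gen_last g -> length_set g n l.
Proof.
move=> sg lt1g a_gt0.
have lt_ab := gen_first_lt_last g sg lt1g.
have [Y YP] := length_of_monoid_M g sg lt1g.
have [X XP] := length_of_monoid_m g sg lt1g.
(* From l n_k >= n follows l >= X + Y, so x + y = l (n_k - n_1) >= X + Y, and x >= X or y >= Y. *)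
exists ((X + Y) * gen_last g) => n l x y leNn Mx my xn yn.
have le_l : X + Y <= l by rewrite -(leq_pmul2r (ltn_trans a_gt0 lt_ab)); lia.
have le_lab : l * (gen_first g).+1 <= l * gen_last g by rewrite leq_mul2l lt_ab orbT.
rewrite mulnS in le_lab.
have [leY|ltY] := leqP Y y; first exact: YP Mx leY xn yn.
have leX : X <= x by lia.
exact: XP my leX xn yn.
Qed.

(** Both n - l n_1 and n - l' n_1 lie in S_M, so [step g] divides their difference (l' - l) n_1;
    coprimality cancels n_1. *)
Lemma length_congr (g : seq nat) (n l l' : nat) :
  sorted ltn g -> 0 < size g -> coprime (step g) (gen_first g) ->
  length_set g n l -> length_set g n l' -> l <= l' -> step g %| l' - l.
Proof.
move=> sg g0 cop /(length_set_M _ _ _ sg g0)[x Mx xn].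
move=> /(length_set_M _ _ _ sg g0)[x' Mx' x'n] le_ll'.
rewrite -(Gauss_dvdl _ cop) mulnBl.
have le_m : l * gen_first g <= l' * gen_first g by rewrite leq_mul2r le_ll' orbT.
have -> : l' * gen_first g - l * gen_first g = x - x' by lia.
by rewrite dvdn_sub // step_dvd.
Qed.

Local Open Scope ring_scope.

Theorem theorem4p2 (k : nat) (gens : k.-tuple nat) :
  (2 <= k)%N ->
  (forall j : 'I_k, (0 < tnth gens j)%N) ->
  sorted ltn gens ->
  \big[gcdn/0%N]_(j < k) tnth gens j = 1%N ->
  exists N : nat, forall n : nat,
    gen_monoid gens n -> (N <= n)%N ->
    forall i i' : nat,
      (i < gen_first gens)%N -> (i' < gen_last gens)%N ->
      (n = i %[mod gen_first gens])%N -> (n = i' %[mod gen_last gens])%N ->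
      [set l%:Z | l in length_set gens n] =
        progression (min_length gens n) (step gens) (max_length gens n) `\`
        (dilate_shift (step gens)%:Z (gaps_m gens i') (min_length gens n)%:Z `|`
         dilate_shift (- (step gens)%:Z) (gaps_M gens i) (max_length gens n)%:Z).
Proof.
move=> lt1k gens_gt0 sg gcd1; set g := tval gens.
have sz : size g = k by rewrite size_tuple.
have lt1g : (1 < size g)%N by rewrite sz.
have g0 := ltnW lt1g.
have a_gt0 : (0 < gen_first g)%N.
  have k_gt0 := ltnW lt1k.
  by have := gens_gt0 (Ordinal k_gt0); rewrite (tnth_nth 0%N) nth0.
have cop : coprime (step g) (gen_first g).
  apply: coprime_step => //; rewrite -gcd1 sz.
  by apply: eq_bigr => j _; rewrite (tnth_nth 0%N).
have [N1 maxP] := max_length_b1 g sg lt1g a_gt0.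
have [N2 minP] := min_length_c1 g sg lt1g a_gt0.
have [N3 lenP] := length_of_monoids g sg lt1g a_gt0.
exists (N1 + N2 + N3)%N => n Sn leNn i i' lti lti' ni ni'.
have leN1 : (N1 <= n)%N by lia.
have leN2 : (N2 <= n)%N by lia.
have leN3 : (N3 <= n)%N by lia.
have [LM leM bM] := maxP n i Sn leN1 lti ni.
have [Lm lem cm] := minP n i' Sn leN2 lti' ni'.
set m := min_length g n in Lm lem cm *.
set M := max_length g n in LM leM bM *.
apply/seteqP; split=> z /=.
  move=> [l Ll <-]; split.
    have /dvdnP[j jE] := length_congr g n m l sg g0 cop Lm Ll (lem l Ll).
    have := lem l Ll; have := leM l Ll => le_lM le_ml.
    by exists j; rewrite /= -jE subnKC.
  (* If l = m + r d, then [cm] turns l n_k - n into c1 + r d n_k, which lies in S_m because l is a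
     length; so r is no gap. The case l = M - r d is the same with [bM] and S_M. *)
  move=> [[r [r1 notm] rE]|[r [r1 notM] rE]].
    have lE : l = (r * step g + m)%N by lia.
    have [y my yn] := length_set_m g n l sg g0 Ll; apply: notm.
    suff -> : (c1 g i' + r * step g * gen_last g)%N = y by [].
    by move: yn; rewrite lE mulnDl; lia.
  have ME : M = (r * step g + l)%N by lia.
  have [x Mx xn] := length_set_M g n l sg g0 Ll; apply: notM.
  suff -> : (b1 g i + r * step g * gen_first g)%N = x by [].
  by move: bM; rewrite ME mulnDl; lia.
move=> [[j /= le_jM <-] nhole]; exists (m + j * step g)%N => //.
set l := (m + j * step g)%N in le_jM nhole *.
(* Gap sets contain only r >= 1, so the endpoints m (j = 0) and M (p = 0) are treated apart; both
   are lengths already. *)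
have [j0|j_gt0] := posnP j; first by rewrite /l j0 addn0.
have /dvdnP[p pE] : (step g %| M - l)%N.
  rewrite /l subnDA dvdn_sub ?dvdn_mull //.
  exact: length_congr cop Lm LM (leM m Lm).
have [p0|p_gt0] := posnP p.
  by suff -> : l = M by []; move: pE; rewrite p0; lia.
(* By [bM] and [cm] these are n - l n_1 and l n_k - n. If one were outside its monoid, l would be
   removed, as the point [p] steps below M or [j] steps above m. *)
apply: (lenP n l (b1 g i + p * step g * gen_first g)%N
                 (c1 g i' + j * step g * gen_last g)%N) => //.
- apply: contrapT => notM; apply: nhole; right; exists p; first by split.
  by lia.
- apply: contrapT => notm; apply: nhole; left; exists j; first by split.
  by lia.
- by rewrite -pE mulnBl -addnA subnK ?leq_mul2r ?le_jM ?orbT.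
- by rewrite /l mulnDl; lia.
Qed.
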